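(* Let $S$ be a set and let $K_1,K_2$ be isomorphism classes of simplicial complexes over $S$. If $K_1$ and $K_2$ are finite dimensional, then they admit representatives $\mathcal{K}_1\in K_1$, $\mathcal{K}_2\in K_2$ such that $d(K_1,K_2)=d(\mathcal{K}_1,\mathcal{K}_2)$.
   Context: $\mathcal{P}_f^*(S)$ is the collection of all non-empty finite subsets of $S$. A simplicial complex over $S$ is a non-empty collection $\mathcal{K}\subset\mathcal{P}_f^*(S)$ such that every non-empty subset of an element of $\mathcal{K}$ belongs to $\mathcal{K}$; it is finite dimensional if the cardinalities of its elements are bounded. $\Omega=[0,1]$ with Lebesgue measure $\lambda$. $L(\mathcal{K})$ is the set of measurable maps $f:\Omega\to S$, identified when equal almost everywhere, such that $f(\Omega)\in\mathcal{K}$, where $f(\Omega)$ denotes the set $\{s\in S : \lambda(f^{-1}(s))>0\}$ and $f$ takes its values in this set almost everywhere. The metric is $d(f,g)=\lambda(\{t\in\Omega : f(t)\neq g(t)\})$. The distance between simplicial complexes is the Hausdorff distance $d(\mathcal{K}_1,\mathcal{K}_2)=\max(\delta(\mathcal{K}_1,\mathcal{K}_2),\delta(\mathcal{K}_2,\mathcal{K}_1))$ with $\delta(\mathcal{K}_1,\mathcal{K}_2)=\sup_{f\in L(\mathcal{K}_1)}\inf_{g\in L(\mathcal{K}_2)}d(f,g)$. Let $\mathfrak{S}(S)$ be the group of all permutations of $S$, acting on simplicial complexes by $\sigma(\mathcal{K})=\{\sigma(F):F\in\mathcal{K}\}$. An isomorphism class is an orbit of this action, and $d(K_1,K_2)=\inf_{\mathcal{K}_1\in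 K_1,\,\mathcal{K}_2\in K_2}d(\mathcal{K}_1,\mathcal{K}_2)=\inf_{\sigma\in\mathfrak{S}(S)}d(\mathcal{K}_1,\sigma(\mathcal{K}_2))$ for any fixed representatives in the last expression. *)

(* Defs.v *)
From HB Require Import structures.
From mathcomp Require Import all_boot all_order all_algebra.
From mathcomp Require Import all_classical all_reals all_analysis.

Set Implicit Arguments.
Unset Strict Implicit.
Unset Printing Implicit Defensive.

Import Order.TTheory GRing.Theory Num.Theory.
Import numFieldNormedType.Exports.

Local Open Scope classical_set_scope.
Local Open Scope ring_scope.
Local Open Scope ereal_scope.

Section complexes.
Context {S : Type}.
Implicit Types (K : set (set S)) (C : set (set (set S))).

Definition simplicial_complex K : Prop :=
  [/\ K !=set0,
      forall F, K F -> finite_set F /\ F !=set0 &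
      forall F G, K F -> G `<=` F -> G !=set0 -> K G].

Definition finite_dimensional K : Prop :=
  exists n : nat, forall F, K F -> (F #<= `I_n)%card.

Definition perm_complex (sigma : S -> S) K : set (set S) :=
  [set sigma @` F | F in K].

Definition perm_orbit K : set (set (set S)) :=
  [set perm_complex sigma K | sigma in [set sigma | bijective sigma]].

Definition isomorphism_class C : Prop :=
  exists2 K, simplicial_complex K & C = perm_orbit K.

End complexes.

Section distances.
Context {R : realType} {S : Type}.

(* The real line with its sigma-algebra of Lebesgue-measurable sets. *)
Definition lebesgueR : measurableType _ :=
  caratheodory_type ((wlength (@idfun R))^*)%mu.

Definition lambda : {measure set lebesgueR -> \bar R} :=
  completed_lebesgue_measure.

Definition Omega : set lebesgueR := `[0%R, 1%R]%classic.

(* A map from Omega to S is encoded by a total function on the line, of which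
   only the restriction to Omega is ever used. *)
Implicit Types f g : lebesgueR -> S.

(* This is measurable_fun with the sigma-algebra of all subsets on S; that
   predicate would need S to be a pointed type. *)
Definition measurable_map f : Prop :=
  forall A : set S, measurable (Omega `&` f @^-1` A).

Definition ess_image f : set S :=
  [set s | 0 < lambda (Omega `&` f @^-1` [set s])].

(* Maps that are equal almost everywhere are not identified here: by L_ae and
   dist_ae below, membership in L K and the distance do not distinguish them, so
   the suprema and infima are those over the quotient. *)
Definition L (K : set (set S)) : set (lebesgueR -> S) :=
  [set f | [/\ measurable_map f,
               K (ess_image f) &
               {ae lambda, forall t, Omega t -> ess_image f (f t)}]].

Definition dist f g : \bar R := lambda (Omega `&` [set t | f t <> g t]).

Definition delta (K1 K2 : set (set S)) : \bar R :=
  ereal_sup [set ereal_inf [set dist f g | g in L K2] | f in L K1].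

Definition complex_dist (K1 K2 : set (set S)) : \bar R :=
  maxe (delta K1 K2) (delta K2 K1).

Definition class_dist (C1 C2 : set (set (set S))) : \bar R :=
  ereal_inf [set complex_dist K1 K2 | K1 in C1 & K2 in C2].

Lemma lambda_le_ae (A B : set lebesgueR) :
  {ae lambda, forall t, A t -> B t} -> lambda A <= lambda B.
Proof.
move=> [N [mN N0 AN]].
apply: (@le_trans _ _ (lambda (B `|` N))).
  apply: (@le_outer_measure _ _ ((wlength (@idfun R))^*)%mu) => t At.
  by have [Bt|nBt] := pselect (B t); [left|right; apply: AN => /(_ At)].
apply: le_trans (outer_measureU2 ((wlength (@idfun R))^*)%mu _ _) _.
by rewrite [X in _ + X]N0 adde0.
Qed.

Lemma measurable_ae (A B : set lebesgueR) :
  {ae lambda, forall t, A t <-> B t} -> measurable A -> measurable B.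
Proof.
move=> [N [mN N0 AN]] mA.
have mNS C : C `<=` N -> measurable C.
  by move=> CN; apply: completed_lebesgue_measure_is_complete; exists N.
have -> : B = (A `\` (A `\` B)) `|` (B `\` A).
  apply/seteqP; split=> t; last by move=> [[At] /not_andP[//|/contrapT]|[]].
  move=> Bt; have [At|nAt] := pselect (A t); last by right.
  by left; split=> // -[].
apply: measurableU; first apply: measurableD => //.
all: by apply: mNS => t [h nh]; apply: AN => -[]; auto.
Qed.

Definition eq_ae f g : Prop := {ae lambda, forall t, Omega t -> f t = g t}.

Lemma eq_ae_sym f g : eq_ae f g -> eq_ae g f.
Proof. by apply: filterS => t fg /fg. Qed.

Lemma eq_ae_ess_image f g : eq_ae f g -> ess_image f = ess_image g.
Proof.
move=> fg; apply/seteqP; split=> s /= /lt_le_trans; apply; apply: lambda_le_ae.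
  by apply: filterS fg => t fg [Ot] /= fs; rewrite -fg.
by apply: filterS fg => t fg [Ot] /= gs; split=> //=; rewrite fg.
Qed.

Lemma L_ae (K : set (set S)) f g : eq_ae f g -> L K f -> L K g.
Proof.
move=> fg [mf Kf fK]; rewrite /L/= -(eq_ae_ess_image fg); split=> //.
  move=> A; apply: measurable_ae (mf A); apply: filterS fg => t fg.
  by split=> -[Ot] /=; rewrite fg.
by apply: filterS2 fg fK => t fg fK Ot; rewrite -fg//; exact: fK.
Qed.

Lemma dist_ae f f' g g' : eq_ae f f' -> eq_ae g g' -> dist f g = dist f' g'.
Proof.
move=> ff gg; apply/eqP; rewrite eq_le; apply/andP; split.
  by apply: lambda_le_ae; apply: filterS2 ff gg => t ff gg [Ot] /=; rewrite ff ?gg.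
by apply: lambda_le_ae; apply: filterS2 ff gg => t ff gg [Ot] /=; rewrite -ff -?gg.
Qed.

End distances.
Arguments lambda R : clear implicits.
Arguments Omega R : clear implicits.
Arguments complex_dist R {S} K1 K2.
Arguments class_dist R {S} C1 C2.

(* Main.v *)
Require Import Defs.
From mathcomp Require Import all_boot all_order all_algebra finmap.
From mathcomp Require Import all_classical all_reals all_analysis.

(** For finite dimensional complexes, the distance takes only finitely many
    values as the two complexes run through their isomorphism classes, so
    that the infimum defining the class distance is a minimum.

    The reason is that a map [f] with essential image [F] is best approximated
    by maps of [L K] in the following way: choose a face [G] of [K], keep [f]
    where it takes its values in [G], and send the rest anywhere in [G].  Hence
    the distance from [f] to [L K] is the infimum over the faces [G] of [K] of
    the measure of the set where [f] is not in [G] ([ereal_inf_dist]), and this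
    involves only the traces of [K] on [F].  Taking the supremum over all [f]
    with essential image [F] yields a number, [deficit F K], which depends only
    on the combinatorial type of the pair formed by the finite set [F] and the
    family of its subsets [F `&` G] ([deficit_inj]).  If [F] has at most [n]
    points, this type is one of the finitely many pairs made of a subset of
    ['I_n] and a family of subsets of ['I_n] ([deficit_pattern]).

    Now [delta K1 K2] is the supremum of [deficit F K2] over the faces [F] of
    [K1] ([delta_deficit]): it is the supremum of a subset of a fixed finite set
    of values, which leaves finitely many possibilities ([delta_pattern]).  As
    permutations of [S] preserve cardinalities, a single [n] serves for a whole
    isomorphism class. *)

Set Implicit Arguments.
Unset Strict Implicit.
Import Order.TTheory GRing.Theory Num.Theory.
Local Open Scope classical_set_scope.
Local Open Scope ereal_scope.

Section essential_image.
Context {R : realType} {S : Type}.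
Implicit Types (f : @lebesgueR R -> S) (F : set S).

Lemma Omega_lambda_gt0 : 0 < lambda R (Omega R).
Proof.
have -> : lambda R (Omega R) = @lebesgue_measure R `[0%R, 1%R]%classic by [].
by rewrite lebesgue_measure_itv /= lte_fin ltr01 oppr0 addr0 lte_fin ltr01.
Qed.

Lemma ess_image_sub f F :
  {ae lambda R, forall t, Omega R t -> F (f t)} -> ess_image f `<=` F.
Proof.
move=> fF s /= fs; apply: contrapT => nFs; move: fs; apply/negP; rewrite -leNgt.
rewrite -(measure0 (lambda R)); apply: lambda_le_ae.
by apply: filterS fF => t fF [/fF + /= fts]; rewrite fts.
Qed.

Lemma ess_image_neq0 f :
  {ae lambda R, forall t, Omega R t -> ess_image f (f t)} ->
  ess_image f !=set0.
Proof.
move=> fE; apply/set0P/negP => /eqP f0; move: Omega_lambda_gt0.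
apply/negP; rewrite -leNgt -(measure0 (lambda R)); apply: lambda_le_ae.
by apply: filterS fE => t + Ot => /(_ Ot); rewrite f0.
Qed.

(** Among finitely many values, those taken with measure zero account together
    for a null set; this fails for a map with a continuous distribution. *)
Lemma ess_image_finite_ae f F : measurable_map f -> finite_set F ->
  {ae lambda R, forall t, Omega R t -> F (f t)} ->
  {ae lambda R, forall t, Omega R t -> ess_image f (f t)}.
Proof.
move=> mf /(@finite_fsetP {classic S})[X ->] fX.
have fbig : \forall t \ae lambda R, forall s : {classic S}, s \in X ->
    Omega R t -> f t = s -> ess_image f s.
  (* Finite intersections of families indexed by a bare type need a choice
     structure, which the alias [{classic S}] provides. *)
  apply: (@filter_bigI _ {classic S} X
    (fun s => [set t | Omega R t -> f t = s -> ess_image f s])) => s _.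
  have [fs|nfs] := pselect (ess_image f s); first by apply: aeW => t /=.
  exists (Omega R `&` f @^-1` [set s]); split; first exact: mf.
    by apply/eqP; rewrite eq_le measure_ge0 andbT leNgt; apply/negP.
  by move=> t /= nt; apply: contrapT => nO; apply: nt => Ot fts; case: nO.
by apply: filterS2 fX fbig => t Xft h Ot; apply: (h (f t)) => //; exact: Xft.
Qed.

End essential_image.

Section deficit.
Context {R : realType}.

(** The largest distance from a map with essential image [F] to [L K]; by
    [ereal_inf_dist] the inner infimum is that distance when [K] is a simplicial
    complex.  The formula makes sense for every family [K] of sets, so that it
    also applies to the family of traces of a complex on [F]. *)
Definition deficit {S : Type} (F : set S) (K : set (set S)) : \bar R :=
  ereal_sup [set ereal_inf [set lambda R (Omega R `&` [set t | ~ G (f t)])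
                           | G in K] | f in L [set F]].

(** A map [g] with essential image [G] differs from [f] wherever [f] avoids [G].
    Conversely, given a face [G], the map that agrees with [f] where [f] lies in
    [G] and is constant in [G] elsewhere has its essential image inside [G],
    hence in [K2], although this image may be smaller than [G]. *)
Lemma ereal_inf_dist {S : Type} (K1 K2 : set (set S)) (f : @lebesgueR R -> S) :
  simplicial_complex K2 -> L K1 f ->
  ereal_inf [set dist f g | g in L K2] =
  ereal_inf [set lambda R (Omega R `&` [set t | ~ G (f t)]) | G in K2].
Proof.
move=> [K20 K2fin K2sub] [mf _ _]; apply/eqP; rewrite eq_le; apply/andP; split.
  apply/ereal_infP => _ [G KG <-].
  have [Gfin [s0 Gs0]] := K2fin _ KG.
  pose g t := if `[< G (f t) >] then f t else s0.
  have gG t : G (g t) by rewrite /g; case: asboolP.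
  have mg : measurable_map g.
    move=> A; have [As|nAs] := pselect (A s0).
      have -> : Omega R `&` g @^-1` A = Omega R `&` f @^-1` (A `|` ~` G).
        by apply/seteqP; split=> t [Ot] /=; rewrite /g; case: asboolP;
          intuition.
      exact: mf.
    have -> : Omega R `&` g @^-1` A = Omega R `&` f @^-1` (A `&` G).
      by apply/seteqP; split=> t [Ot] /=; rewrite /g; case: asboolP; intuition.
    exact: mf.
  have aG : {ae lambda R, forall t, Omega R t -> G (g t)} by exact: aeW.
  have ag := ess_image_finite_ae mg Gfin aG.
  have gL : L K2 g.
    split=> //; apply: K2sub KG _ _; first exact: ess_image_sub.
    exact: ess_image_neq0.
  apply: ge_ereal_inf; exists (dist f g); first by exists g.
  apply: lambda_le_ae; apply: aeW => t [Ot] /= fg; split=> //= Gf.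
  by apply: fg; rewrite /g; case: asboolP.
apply/ereal_infP => _ [g [mg Kg ag] <-].
apply: ge_ereal_inf.
exists (lambda R (Omega R `&` [set t | ~ ess_image g (f t)])).
  by exists (ess_image g).
apply: lambda_le_ae; apply: filterS ag => t ag [Ot] /= nf; split=> //= fg.
by apply: nf; rewrite fg; exact: ag.
Qed.

(** [L K1] is the union of the [L [set F]] over the faces [F] of [K1]. *)
Lemma delta_deficit {S : Type} (K1 K2 : set (set S)) : simplicial_complex K2 ->
  delta K1 K2 = ereal_sup [set deficit F K2 | F in K1].
Proof.
move=> sK2; apply/eqP; rewrite eq_le; apply/andP; split.
  apply/ereal_supP => _ [f Lf <-]; rewrite (ereal_inf_dist sK2 Lf).
  have [mf Kf af] := Lf.
  apply: (@le_trans _ _ (deficit (ess_image f) K2)); apply: ereal_sup_ubound.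
    by exists f.
  by exists (ess_image f).
apply/ereal_supP => _ [F KF <-]; apply/ereal_supP => _ [f [mf /= fF af] <-].
have Lf : L K1 f by split=> //; rewrite fF.
rewrite -(ereal_inf_dist sK2 Lf).
by apply: ereal_sup_ubound; exists f.
Qed.

Lemma L_comp {S S' : Type} (u : S -> S') (F : set S) (f : @lebesgueR R -> S) :
  L [set F] f -> L [set u @` F] (u \o f).
Proof.
move=> [mf /= fF af]; rewrite fF in af.
have uF : {ae lambda R, forall t, Omega R t -> (u @` F) ((u \o f) t)}.
  by apply: filterS af => t af Ot; exists (f t) => //; exact: af.
have eF : ess_image (u \o f) = u @` F.
  apply/seteqP; split; first exact: ess_image_sub.
  move=> _ [s + <-]; rewrite -fF => /= fs; apply: lt_le_trans fs _.
  by apply: lambda_le_ae; apply: aeW => t [Ot] /= <-.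
by split=> //=; [move=> A; exact: (mf (u @^-1` A))|rewrite eF].
Qed.

(** Composition with [u] turns a map with essential image [F] into one with
    essential image [u @` F]; the hypothesis says that, on [F], every member of
    [K'] pulls back into a member of [K], so that [u \o f] avoids the former
    wherever [f] avoids the latter. *)
Lemma deficit_le {S S' : Type} (u : S -> S') (F : set S)
    (K : set (set S)) (K' : set (set S')) :
  (forall G', K' G' -> exists2 G, K G & forall s, F s -> G' (u s) -> G s) ->
  deficit F K <= deficit (u @` F) K'.
Proof.
move=> KK'; apply/ereal_supP => _ [f Lf <-].
apply: (@le_trans _ _ (ereal_inf
    [set lambda R (Omega R `&` [set t | ~ G ((u \o f) t)]) | G in K'])); last first.
  by apply: ereal_sup_ubound; exists (u \o f) => //; exact: L_comp.
apply/ereal_infP => _ [G' /KK'[G KG GG'] <-].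
apply: ge_ereal_inf; exists (lambda R (Omega R `&` [set t | ~ G (f t)])).
  by exists G.
case: Lf => _ /= fF; rewrite fF => af.
apply: lambda_le_ae; apply: filterS af => t af [Ot] /= nG; split=> //= uG.
by apply: nG; apply: GG' => //; exact: af.
Qed.

(** Both inequalities are instances of [deficit_le], for [u] and for an inverse
    [v] of [u] on [F]. *)
Lemma deficit_inj {S S' : Type} (u : S -> S') (F : set S) (K : set (set S)) :
  F !=set0 -> {in F &, injective u} ->
  deficit F K = deficit (u @` F) [set u @` (F `&` G) | G in K].
Proof.
move=> [s0 Fs0] injuF.
have injF s s' : F s -> F s' -> u s = u s' -> s = s'.
  by move=> Fs Fs'; apply: injuF; exact: mem_set.
apply/eqP; rewrite eq_le; apply/andP; split.
  apply: deficit_le => _ [G KG <-]; exists G => // s Fs [s' [Fs' Gs']].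
  by move=> /injF <-.
have [v vK] : exists v : S' -> S, forall s, F s -> v (u s) = s.
  have /choice[v vP] : forall x, exists s, (u @` F) x -> F s /\ u s = x.
    move=> x; have [[s Fs <-]|nx] := pselect ((u @` F) x); first by exists s.
    by exists s0.
  by exists v => s Fs; have [|Fv] := vP (u s); [exists s|exact: injF].
have vuF : F = v @` (u @` F).
  apply/seteqP; split=> [s Fs|_ [_ [s Fs <-] <-]]; last by rewrite vK.
  by exists (u s); [exists s|exact: vK].
rewrite [in leRHS]vuF; apply: deficit_le => G KG.
exists (u @` (F `&` G)); first by exists G.
by move=> _ [s Fs <-]; rewrite vK// => Gs; exists s.
Qed.

End deficit.

Section finitely_many_values.
Context {R : realType}.

(** A finite type rich enough to record, up to relabelling, any set with at most
    [n] points together with a family of its subsets. *)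
Definition pattern (n : nat) : finType := ({set 'I_n} * {set {set 'I_n}})%type.

Definition pattern_deficit n (p : pattern n) : \bar R :=
  deficit [set` p.1] [set [set` A] | A in [set` p.2]].

Lemma deficit_pattern {S : Type} n (F : set S) (K : set (set S)) :
  F !=set0 -> (F #<= `I_n)%card ->
  exists p : pattern n, deficit F K = pattern_deficit p.
Proof.
move=> F0 Fn.
have [u injuF] : exists u : S -> 'I_n, {in F &, injective u}.
  have [s0 Fs0] := F0.
  have [v vn vinj] : exists2 v : S -> nat, set_fun F `I_n v & set_inj F v.
    by apply/injfunPex/pcard_leP.
  (* As [F] is nonempty, [n] is positive and [inord] is available. *)
  case: n Fn vn => [|n] Fn vn; first by have := vn _ Fs0.
  exists (fun s => inord (v s)) => s s' Fs Fs' /(congr1 val).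
  by rewrite /= !inordK; [exact: vinj|apply: vn; exact: set_mem..].
pose setof (A : set 'I_n) : {set 'I_n} := [set i | `[< A i >]]%SET.
have setofK A : [set` setof A] = A.
  by apply/seteqP; split=> i /=; rewrite inE; [move/asboolP|move=> ?; apply/asboolP].
exists (setof (u @` F),
  [set B : {set 'I_n} | `[< exists2 G, K G & B = setof (u @` (F `&` G)) >]]%SET).
rewrite (deficit_inj K F0 injuF) /pattern_deficit /= setofK; congr deficit.
apply/seteqP; split=> [_ [G KG <-]|_ [B + <-]] /=.
  exists (setof (u @` (F `&` G))); last exact: setofK.
  by rewrite /= inE; apply/asboolP; exists G.
by rewrite /= inE => /asboolP[G KG ->]; exists G; rewrite ?setofK.
Qed.

Lemma delta_pattern {S : Type} n (K1 K2 : set (set S)) :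
  simplicial_complex K1 -> simplicial_complex K2 ->
  (forall F, K1 F -> (F #<= `I_n)%card) ->
  exists B : {set pattern n}, @delta R S K1 K2 =
    ereal_sup [set pattern_deficit p | p in [set` B]].
Proof.
move=> [_ K1fin _] sK2 K1n; rewrite delta_deficit//.
exists [set p : pattern n |
  `[< exists2 F, K1 F & deficit F K2 = pattern_deficit p >]]%SET.
congr ereal_sup; apply/seteqP; split=> [_ [F KF <-]|_ [p + <-]] /=.
  have [p Fp] := deficit_pattern K2 (K1fin _ KF).2 (K1n _ KF).
  by exists p => //=; rewrite inE; apply/asboolP; exists F.
by rewrite /= inE => /asboolP[F KF Fp]; exists F.
Qed.

Lemma ereal_inf_attained (I : finType) (w : I -> \bar R) (X : set (\bar R)) :
  X !=set0 -> X `<=` range w -> X (ereal_inf X).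
Proof.
move=> [x0 Xx0] Xw; have [i0 _ wi0] := Xw _ Xx0.
have Pi0 : `[< X (w i0) >] by apply/asboolP; rewrite wi0.
case: (@arg_minP _ _ _ i0 (fun i => `[< X (w i) >]) w Pi0) => i /asboolP Xi imin.
suff -> : ereal_inf X = w i by [].
apply/eqP; rewrite eq_le ereal_inf_lbound//=; apply/ereal_infP => y Xy.
by have [j _ wj] := Xw _ Xy; rewrite -wj imin//; apply/asboolP; rewrite wj.
Qed.

End finitely_many_values.

Section isomorphism_classes.
Context {S : Type}.

(** Direct images of faces are closed under nonempty subsets because
    [G `<=` sigma @` F] is the image of the face [F `&` sigma @^-1` G]. *)
Lemma perm_complex_simplicial (sigma : S -> S) (K : set (set S)) :
  simplicial_complex K -> simplicial_complex (perm_complex sigma K).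
Proof.
move=> [[F0 KF0] Kfin Ksub]; split.
- by exists (sigma @` F0), F0.
- move=> _ [F KF <-]; have [Ff [s Fs]] := Kfin _ KF.
  by split; [exact: finite_image|exists (sigma s), s].
- move=> _ G [F KF <-] GF [x Gx].
  exists (F `&` sigma @^-1` G).
    apply: Ksub KF _ _; first by move=> s [].
    by have [s Fs sx] := GF _ Gx; exists s; split=> //=; rewrite sx.
  apply/seteqP; split=> [_ [s [_ Gs] <-] //|y Gy].
  by have [s Fs sy] := GF _ Gy; exists s => //; split=> //=; rewrite sy.
Qed.

Lemma class_simplicial (C : set (set (set S))) K :
  isomorphism_class C -> C K -> simplicial_complex K.
Proof. by move=> [K0 sK0 ->] [sigma _ <-]; exact: perm_complex_simplicial. Qed.

Lemma class_neq0 (C : set (set (set S))) : isomorphism_class C -> C !=set0.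
Proof.
by move=> [K0 sK0 ->]; exists (perm_complex id K0), id => //; exists id.
Qed.

(** The dimension bound of one member of the class is inherited by the others,
    since their faces are images of its faces. *)
Lemma class_card_bound (C : set (set (set S))) :
  isomorphism_class C -> (forall K, C K -> finite_dimensional K) ->
  exists n, forall K, C K -> forall F, K F -> (F #<= `I_n)%card.
Proof.
move=> [K0 sK0 ->] fd.
have [n Kn] : finite_dimensional (perm_complex id K0).
  by apply: fd; exists id => //; exists id.
exists n => _ [sigma _ <-] _ [F KF <-]; apply: card_le_trans (card_image_le _ _) _.
by apply: Kn; exists F => //; exact: image_id.
Qed.

End isomorphism_classes.

Theorem proposition4p3 (R : realType) (S : Type) (C1 C2 : set (set (set S)))
  (isoC1 : isomorphism_class C1) (isoC2 : isomorphism_class C2)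
  (fdC1 : forall K, C1 K -> finite_dimensional K)
  (fdC2 : forall K, C2 K -> finite_dimensional K) :
  exists K1 K2 : set (set S),
    [/\ C1 K1, C2 K2 & class_dist R C1 C2 = complex_dist R K1 K2].
Proof.
have [n C1n] := class_card_bound isoC1 fdC1.
have [m C2m] := class_card_bound isoC2 fdC2.
pose w (B : {set pattern n} * {set pattern m}) : \bar R :=
  maxe (ereal_sup [set pattern_deficit p | p in [set` B.1]])
       (ereal_sup [set pattern_deficit p | p in [set` B.2]]).
have [||K1 CK1 [K2 CK2 K12]] := @ereal_inf_attained R _ w
    [set complex_dist R K1 K2 | K1 in C1 & K2 in C2].
- have [[K1 CK1] [K2 CK2]] := (class_neq0 isoC1, class_neq0 isoC2).
  by exists (complex_dist R K1 K2), K1 => //; exists K2.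
- move=> _ [K1 CK1 [K2 CK2 <-]].
  have sK1 := class_simplicial isoC1 CK1; have sK2 := class_simplicial isoC2 CK2.
  have [B1 dB1] := @delta_pattern R _ _ _ _ sK1 sK2 (C1n _ CK1).
  have [B2 dB2] := @delta_pattern R _ _ _ _ sK2 sK1 (C2m _ CK2).
  by exists (B1, B2); rewrite // /complex_dist dB1 dB2.
by exists K1, K2.
Qed.
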